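(* Let $k\ge1$, let $G$ and $G'$ be graphs, where $G'$ has no isolated vertices, and let $t\in V(G)$. Suppose that $G$ is $3$-connected, that $M_k(G)$ has at least one circuit, that $s(t,G)=\rho^*_k(G)+1$ and $s(x,G)\le\rho^*_k(G)$ for every vertex $x$ of $G$ distinct from $t$, and that $M_k(G')=M_k(G)$. Then $\mathcal{S}(G)=\mathcal{S}(G')$, i.e. $G$ and $G'$ are strongly isomorphic.
   Context: Graphs are finite and may have loops and parallel edges, except that a $3$-connected graph means a simple graph with at least $4$ vertices that stays connected after deletion of any set of at most $2$ vertices. For $X\subseteq E(G)$, $G\langle X\rangle$ is the subgraph of $G$ with edge set $X$ whose vertices are the end-vertices of edges in $X$. $\Delta G=|E(G)|-|V(G)|$. $\mathcal{G}_{\bowtie}$ is the set of graphs having no isolated vertices, no leaves (vertices of degree 1, a loop contributing 2 to the degree), and no cycle components (components that are cycles; a vertex with a single loop is a cycle, and two parallel edges form a cycle). For $k\ge1$ the $k$-circular matroid $M_k(G)$ is the matroid on $E(G)$ whose circuits are the sets $C\subseteq E(G)$ with $\Delta G\langle C\rangle=k$ and $G\langle C\rangle\in\mathcal{G}_{\bowtie}$ (these are known to be the circuits of a matroid). $\rho^*_k(G)$ is the corank of $M_k(G)$, i.e. $|E(G)|$ minus the rank of $M_k(G)$. Equality $M_k(G)=M_k(G')$ means equality of ground sets $E(G)=E(G')$ and of the families of circuits. $S(x,G)$ is the set of edges of $G$ incident to $x$ (loops included), $s(x,G)=|S(x,G)|$, and $\mathcal{S}(G)=\{S(x,G):x\in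 V(G)\}$. Graphs $G=(V,E,\phi)$ and $G'=(V',E,\phi')$ with the same edge set are strongly isomorphic if there is a bijection $\nu:V\to V'$ such that for each edge $e$: $\phi(e)=\{x,y\}\Leftrightarrow\phi'(e)=\{\nu(x),\nu(y)\}$, where $\phi(e)$ is the set of end-vertices of $e$. *)

(* Defs.v *)
From HB Require Import structures.
From mathcomp Require Import all_boot all_order all_algebra.

Set Implicit Arguments.
Unset Strict Implicit.
Unset Printing Implicit Defensive.

(* Finite graphs, loops and parallel edges allowed.  The vertex and edge sets  *)
(* are subsets of ambient finite types, so that subgraphs are again graphs and *)
(* graphs can share an edge set.  ends G e is the set of end-vertices of e: it *)
(* has one element for a loop, two otherwise, and is meaningless when          *)
(* e \notin edges G.                                                           *)
Record mgraph (V E : finType) := MGraph {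
  verts : {set V};
  edges : {set E};
  ends : E -> {set V};
  ends_sub : forall e, e \in edges -> ends e \subset verts;
  ends_card : forall e, e \in edges -> 0 < #|ends e| <= 2
}.

Section Subgraphs.
Variables (V E : finType) (G : mgraph V E).

Section EdgeSub.
Variable X : {set E}.

Let verts_of := \bigcup_(e in X :&: edges G) ends G e.

Fact edge_sub_sub e : e \in X :&: edges G -> ends G e \subset verts_of.
Proof. by move=> eX; apply: (bigcup_sup e). Qed.

Fact edge_sub_card e : e \in X :&: edges G -> 0 < #|ends G e| <= 2.
Proof. by case/setIP=> _ /ends_card. Qed.

(* G<X>: the subgraph with edge set X and no isolated vertices. *)
Definition edge_sub : mgraph V E := MGraph edge_sub_sub edge_sub_card.
End EdgeSub.

Section VertSub.
Variable W : {set V}.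

Let edges_in := [set e in edges G | ends G e \subset W].

Fact vert_sub_sub e : e \in edges_in -> ends G e \subset W :&: verts G.
Proof. by rewrite inE => /andP[/ends_sub eV eW]; rewrite subsetI eW eV. Qed.

Fact vert_sub_card e : e \in edges_in -> 0 < #|ends G e| <= 2.
Proof. by rewrite inE => /andP[/ends_card]. Qed.

(* The subgraph induced by W. *)
Definition vert_sub : mgraph V E := MGraph vert_sub_sub vert_sub_card.
End VertSub.

End Subgraphs.

Section GraphNotions.
Variables V E : finType.
Implicit Type G : mgraph V E.

(* S(x, G) *)
Definition star G x : {set E} := [set e in edges G | x \in ends G e].

Definition stars G : {set {set E}} := [set star G x | x in verts G].

Definition loops_at G x : {set E} := [set e in edges G | ends G e == [set x]].

(* Loops belong to star G x, so each of them is counted twice. *)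
Definition degree G x : nat := #|star G x| + #|loops_at G x|.

Definition excess G : int := (#|edges G|%:Z - #|verts G|%:Z)%R.

Definition adjacent G : rel V :=
  [rel x y | [exists e in edges G, (x \in ends G e) && (y \in ends G e)]].

Definition connected G : bool :=
  (verts G != set0) &&
  [forall x in verts G, forall y in verts G, connect (adjacent G) x y].

Definition component G x : mgraph V E :=
  vert_sub G [set y in verts G | connect (adjacent G) x y].

Definition is_cycle G : bool :=
  connected G && [forall x in verts G, degree G x == 2].

Definition no_isolated G : bool := [forall x in verts G, degree G x != 0].

Definition no_leaf G : bool := [forall x in verts G, degree G x != 1].

Definition no_cycle_component G : bool :=
  [forall x in verts G, ~~ is_cycle (component G x)].

Definition bowtie G : bool :=
  [&& no_isolated G, no_leaf G & no_cycle_component G].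

Definition simple G : Prop :=
  {in edges G, forall e, #|ends G e| = 2} /\ {in edges G &, injective (ends G)}.

Definition three_connected G : Prop :=
  [/\ simple G,
      4 <= #|verts G|
    & forall W : {set V}, W \subset verts G -> #|W| <= 2 ->
        connected (vert_sub G (verts G :\: W))].

End GraphNotions.

(* The data of a matroid presented by its circuits: the ground set and the     *)
(* family of circuits.  The circuit axioms are not part of the structure.      *)
Record circuit_system (E : finType) := CircuitSystem {
  ground : {set E};
  circuits : {set {set E}}
}.

Section CircuitSystems.
Variables (E : finType) (M : circuit_system E).

Definition independent (I : {set E}) : bool :=
  (I \subset ground M) && [forall C in circuits M, ~~ (C \subset I)].

Definition rank : nat := \max_(I : {set E} | independent I) #|I|.

Definition corank : nat := #|ground M| - rank.
End CircuitSystems.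

Definition circular_matroid (V E : finType) (k : nat) (G : mgraph V E) :
    circuit_system E :=
  CircuitSystem (edges G)
    [set C : {set E} | [&& C \subset edges G,
                           excess (edge_sub G C) == k%:Z%R
                         & bowtie (edge_sub G C)]].

Definition strongly_isomorphic (V V' E : finType)
    (G : mgraph V E) (G' : mgraph V' E) : Prop :=
  edges G = edges G' /\
  exists2 nu : {x | x \in verts G} -> {x' | x' \in verts G'},
    bijective nu
    & forall e, e \in edges G -> forall x y : {x | x \in verts G},
        ends G e = [set val x; val y] <->
        ends G' e = [set val (nu x); val (nu y)].

(* Main.v *)
(** The independent sets of M_k(G) are the edge sets all of whose subsets Y
satisfy |Y| < |V(Y)| + k.  If a nonempty edge set X has no coloop, then
its rank is |V(X)| + k - 1, so |V(X)| can be read off the matroid.  For x <> t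
this applies to E \ S(x), because G - x stays connected after deleting any edge
and s(x) <= corank leaves enough edges.  Hence E \ S(x) spans all but one vertex
x' of G', and S'(x') <= S(x).  If f were in S(x) \ S'(x'), then f would raise
the rank of E \ S(x) by one in G, because there f is pendant, whereas in G' the
set spans only |V| - 1 vertices.  The bound s(t) = corank + 1 is what this last
argument needs for t, matched with the one vertex t' of G' left over. *)
Require Import Defs.
From mathcomp Require Import all_boot all_order all_algebra.
From mathcomp Require Import zify.

Set Implicit Arguments.
Unset Strict Implicit.
Unset Printing Implicit Defensive.

(** * Degree sums *)

(** An edge contributes its number of ends, plus one if it is a loop, which is two in either case.
    The purpose is that a component with all degrees two has as many edges as vertices. *)
Lemma handshake (V E : finType) (G : mgraph V E) :
  \sum_(x in verts G) degree G x = #|edges G|.*2.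
Proof.
rewrite big_split /= -mul2n mulnC -sum_nat_const.
have sumE (P : V -> pred E) : \sum_(x in verts G) #|[set e in edges G | P x e]|
    = \sum_(e in edges G) \sum_(x in verts G) P x e.
  rewrite exchange_big /=; apply: eq_bigr => x _.
  by rewrite -sum1dep_card big_mkcondr /=; apply: eq_bigr => e _; case: (P x e).
rewrite !sumE -big_split /=; apply: eq_bigr => e eE.
have eV := ends_sub eE; have := ends_card eE.
have -> : \sum_(x in verts G) (x \in ends G e) = #|ends G e|.
  rewrite -sum1_card big_mkcond [RHS]big_mkcond /=; apply: eq_bigr => x _.
  by case: ifP (subsetP eV x) => // _; case: (x \in ends G e) => // /(_ isT).
have [/eqP/cards1P[x ex]|n1] := eqVneq #|ends G e| 1.
  have xV : x \in verts G by apply: (subsetP eV); rewrite ex set11.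
  rewrite ex cards1 (bigD1 x) //= eqxx big1 // => y /andP[_ yx].
  by apply/eqP; rewrite eqb0 eqEsubset sub1set inE eq_sym (negPf yx).
rewrite big1 => [|x _]; first by lia.
by apply/eqP; rewrite eqb0; apply: contraNneq n1 => ->; rewrite cards1.
Qed.

(** * Sparse and tight edge sets, and maximal sparse subsets *)

Section Sparse.
Variables (V E : finType) (G : mgraph V E) (k : nat).
Implicit Types (C I J S T X Y Z : {set E}) (A U W : {set V}).

Definition span X : {set V} := \bigcup_(e in X) ends G e.

(** The strict inequality encodes the bound [#|span Y| + k - 1] without subtraction. Since [Y] may
    be empty, a sparse set exists only if [0 < k]. *)
Definition sparse X : bool :=
  [forall Y : {set E}, (Y \subset X) ==> (#|Y| < #|span Y| + k)].

Definition tight X : bool := #|X|.+1 == #|span X| + k.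

Lemma sparseP X :
  reflect (forall Y, Y \subset X -> #|Y| < #|span Y| + k) (sparse X).
Proof.
apply: (iffP forallP) => h Y; last by apply/implyP; apply: h.
by move=> YX; have /implyP := h Y; apply.
Qed.

Lemma sparseS X Y : X \subset Y -> sparse Y -> sparse X.
Proof.
by move=> XY /sparseP sY; apply/sparseP => Z ZX; apply/sY/(subset_trans ZX).
Qed.

Lemma nsparseP X :
  reflect (exists2 Y : {set E}, Y \subset X & #|span Y| + k <= #|Y|)
    (~~ sparse X).
Proof.
apply: (iffP idP) => [/forallPn[Y]|[Y YX leY]].
  by rewrite negb_imply -leqNgt => /andP[YX leY]; exists Y.
by apply/sparseP => /(_ Y YX); rewrite ltnNge leY.
Qed.

Lemma span_sub X e : e \in X -> ends G e \subset span X.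
Proof. by move=> eX; apply: (bigcup_sup e). Qed.

Lemma mem_span X e x : e \in X -> x \in ends G e -> x \in span X.
Proof. by move=> /span_sub/subsetP; apply. Qed.

Lemma spanS X Y : X \subset Y -> span X \subset span Y.
Proof.
by move=> /subsetP XY; apply/bigcupsP => e /XY eY; apply: span_sub.
Qed.

Lemma spanU X Y : span (X :|: Y) = span X :|: span Y.
Proof. exact: bigcup_setU. Qed.

(** Submodularity of [#|span _|]: the sparsity bound at [S :&: T], valid even when the two sets are
    disjoint, forces equality in the bound at [S :|: T]. *)
Lemma tightU I S T : sparse I -> S \subset I -> T \subset I ->
  tight S -> tight T -> tight (S :|: T).
Proof.
move=> /sparseP sI SI TI /eqP tS /eqP tT.
have lt1 := sI (S :|: T); rewrite subUset SI TI in lt1;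
  move/(_ isT): lt1 => lt1.
have lt2 := sI (S :&: T) (subset_trans (subsetIl _ _) SI).
have le3 : #|span (S :&: T)| <= #|span S :&: span T|.
  by apply: subset_leq_card; rewrite subsetI !spanS // (subsetIl, subsetIr).
have := cardsUI S T; have := cardsUI (span S) (span T).
rewrite /tight spanU in lt1 *; lia.
Qed.

(** A violating subset of [e |: I] must contain [e]. Removing [e] restores the bound, which is
    possible only if the span does not shrink and the bound is attained. *)
Lemma fundamental_tight I e : sparse I -> ~~ sparse (e |: I) ->
  exists S, [/\ S \subset I, tight S & ends G e \subset span S].
Proof.
move=> sI /nsparseP[Y YeI leY]; have /sparseP hI := sI.
have eY : e \in Y.
  apply/negP => /negP eNY; have /hI : Y \subset I; last by rewrite ltnNge leY.
  apply/subsetP => f fY; have /setU1P[fe|//] := subsetP YeI f fY.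
  by rewrite -fe fY in eNY.
have YI : Y :\ e \subset I by rewrite subDset.
have := hI _ YI; have YS := spanS (subD1set Y e); have := subset_leq_card YS.
have := cardsD1 e Y; rewrite eY => c1 c2 c3.
have eqS : span (Y :\ e) = span Y by apply/eqP; rewrite eqEcard YS; lia.
exists (Y :\ e); split=> //; first by rewrite /tight eqS; lia.
by rewrite eqS span_sub.
Qed.

(** Unions of tight subsets of [I] are tight, so one of largest size absorbs the tight sets that
    [fundamental_tight] gives for the individual edges outside [I]. *)
Lemma maximal_sparse_tight X I : ~~ sparse X -> I \subset X -> sparse I ->
  {in X :\: I, forall e, ~~ sparse (e |: I)} ->
  exists T, [/\ T \subset I, tight T &
    {in X :\: I, forall e, ends G e \subset span T}].
Proof.
move=> nX IX sI mI.
have [e0 e0X] : exists e, e \in X :\: I.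
  apply/set0Pn; apply: contraNneq nX => /eqP; rewrite setD_eq0 => XI.
  exact: sparseS XI sI.
have [S0 [S0I tS0 _]] := fundamental_tight sI (mI _ e0X).
pose P S := (S \subset I) && tight S.
have S0P : P S0 by rewrite /P S0I.
case: (@arg_maxnP _ S0 P (fun S => #|S|) S0P) => T /andP[TI tT] maxT.
exists T; split=> // e eX.
have [S [SI tS eS]] := fundamental_tight sI (mI _ eX).
apply: subset_trans eS _; apply: spanS.
have /maxT : P (S :|: T).
  by rewrite /P subUset SI TI (tightU sI).
move=> leST; have /eqP -> : T == S :|: T by rewrite eqEcard subsetUr.
exact: subsetUl.
Qed.

Lemma sparse0 : 0 < k -> sparse set0.
Proof. by move=> k0; apply/sparseP => Y; rewrite subset0 => /eqP->;
  rewrite cards0 ltn_addl. Qed.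

Lemma maximal_sparse_ex X : 0 < k -> exists I, [/\ I \subset X, sparse I &
  {in X :\: I, forall e, ~~ sparse (e |: I)}].
Proof.
move=> k0; pose P S := (S \subset X) && sparse S.
have P0 : P set0 by rewrite /P sub0set sparse0.
case: (@arg_maxnP _ _ P (fun S => #|S|) P0) => I /andP[IX sI] maxI.
exists I; split=> // e /setDP[eX eNI]; apply/negP => sIe.
have /maxI : P (e |: I) by rewrite /P subUset sub1set eX IX.
by rewrite cardsU1 eNI /=; lia.
Qed.

(** The second hypothesis says that [X] has no coloop. It makes the tight set [T] of
    [maximal_sparse_tight] all of [I]: otherwise some [f] in [I :\: T] lies in a violating set [C]
    with [C :\ f] sparse, and counting [C] against [T] gives a contradiction. Then [span I] is
    [span X], and tightness is the claim. *)
Lemma coloopless_sparse_card X I : X != set0 ->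
  {in X, forall e, exists J, [/\ J \subset X :\ e, sparse J & ~~ sparse (e |:
    J)]} ->
  I \subset X -> sparse I -> {in X :\: I, forall e, ~~ sparse (e |: I)} ->
  #|I|.+1 = #|span X| + k.
Proof.
move=> /set0Pn[e0 e0X] coX IX sI mI.
have nX : ~~ sparse X.
  have [J [JX _]] := coX _ e0X; apply: contraNN; apply: sparseS.
  by rewrite subUset sub1set e0X (subset_trans JX) // subD1set.
have [T [TI /eqP tT outT]] := maximal_sparse_tight nX IX sI mI.
suff IT : I \subset T.
  have eqTI : T = I by apply/eqP; rewrite eqEsubset TI.
  subst T; rewrite tT; congr (#|pred_of_set _| + k); apply/eqP.
  rewrite eqEsubset spanS //=; apply/bigcupsP => e eX.
  by case: (boolP (e \in I)) => [/span_sub//|eI]; apply: outT; rewrite inE eI.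
apply/subsetP => f fI; apply: contraT => fNT.
have [J [JX sJ /nsparseP[C CJ leC]]] := coX _ (subsetP IX _ fI).
have /sparseP hJ := sJ; have /sparseP hI := sI.
have CX : C \subset X.
  apply: subset_trans CJ _; rewrite subUset sub1set (subsetP IX) //=.
  exact: subset_trans JX (subD1set _ _).
have fC : f \in C.
  apply: contraT => fNC; have /hJ : C \subset J; last by rewrite ltnNge leC.
  apply/subsetP => g gC; have /setU1P[gf|//] := subsetP CJ g gC.
  by rewrite -gf gC in fNC.
(* Sparsity of T :|: Z gives #|Z| <= #|span C :\: span T|, and sparsity of
   C :\: Z, whose ends lie in span T, gives the strict reverse. *)
pose Z := C :&: (I :\: T).
have ZI : Z \subset I by rewrite subIset // subsetDl orbT.
have ltCZ : #|C :\: Z| < #|span (C :\: Z)| + k.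
  apply: hJ; rewrite subDset; apply: subset_trans CJ _; apply: setSU.
  by rewrite sub1set !inE fC fI fNT.
have leCZ : #|span (C :\: Z)| <= #|span T :&: span C|.
  apply: subset_leq_card; rewrite subsetI; apply/andP; split;
    last exact/spanS/subsetDl.
  apply/bigcupsP => e /setDP[eC eNZ];
    case: (boolP (e \in T)) => [/span_sub//|eNT].
  by apply: outT; move: eNZ; rewrite !inE eC eNT (subsetP CX) //= => ->.
have ltTZ : #|T :|: Z| < #|span T :|: span C| + k.
  have : #|T :|: Z| < #|span (T :|: Z)| + k by apply: hI; rewrite subUset TI.
  move/leq_trans; apply; rewrite leq_add2r spanU subset_leq_card //.
  by rewrite setUS // spanS // subsetIl.
have TZ0 : #|T :&: Z| = 0.
  by apply/eqP; rewrite cards_eq0 -subset0; apply/subsetP => e;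
    rewrite !inE => /and4P[-> _ /negP].
have := cardsUI T Z; have := cardsUI (span T) (span C); have := cardsID Z C.
rewrite (setIidPr (subsetIl C _)) -/Z; clear -tT leC ltCZ leCZ ltTZ TZ0; lia.
Qed.

(** * Connectedness by cuts, and lower bounds for the rank *)

(** Connectedness of the graph on [U] with edges [X], phrased by cuts, so that deleting an edge only
    requires a second edge across the cut. *)
Definition linked U X : Prop :=
  forall A, A \proper U -> A != set0 -> exists e u v,
    [/\ e \in X, u \in ends G e :&: A & v \in ends G e :&: (U :\: A)].

(** Enlarge [W] one vertex at a time along an edge across the cut. That edge then has both ends in
    the enlarged set, so each new vertex uses up a different edge. *)
Lemma linked_edges_out U X W : X \subset edges G -> linked U X ->
  W \subset U -> W != set0 ->
  #|U :\: W| <= #|[set e in X | ~~ (ends G e \subset W)]|.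
Proof.
move=> XE lUX; have [n] := ubnP #|U :\: W|; elim: n W => // n IHn W leW WU W0.
have [->|WNU] := eqVneq W U; first by rewrite setDv cards0.
have pW : W \proper U by rewrite properEneq WNU.
have [e [u [v [eX]]]] := lUX _ pW W0.
rewrite !inE => /andP[ue uW] /and3P[ve vW vU].
have UW : (U :\: W) :\ v = U :\: (v |: W) by rewrite setDDl setUC.
have := cardsD1 v (U :\: W); rewrite !inE vU vW UW /= => cU.
have leIH : #|U :\: (v |: W)| <= #|[set e in X | ~~ (ends G e \subset v |: W)]|.
  apply: IHn; first by clear -leW cU; lia.
    by rewrite subUset sub1set vU.
  by apply/set0Pn; exists v; rewrite setU11.
have evW : ends G e \subset v |: W.
  have uv : u != v by apply: contraNneq vW => <-.
  have euv : [set u; v] = ends G e.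
    apply/eqP; rewrite eqEcard subUset !sub1set ue ve cards2 uv.
    by have /andP[] := ends_card (subsetP XE _ eX).
  by rewrite -euv subUset !sub1set setU11 inE uW orbT.
have lt : [set e in X | ~~ (ends G e \subset v |: W)] \subset
     [set e in X | ~~ (ends G e \subset W)] :\ e.
  apply/subsetP => f; rewrite !inE => /andP[-> fN].
  rewrite (contraNneq _ fN) => [/=|-> //].
  by apply: contraNN fN => fW; apply: subset_trans fW (subsetUr _ _).
have := subset_leq_card lt.
have := cardsD1 e [set e in X | ~~ (ends G e \subset W)]; rewrite inE eX /=.
have -> : ~~ (ends G e \subset W) by apply/subsetPn; exists v.
clear -cU leIH; lia.
Qed.

(** A sparse [X] serves as [I], with its size given by the second alternative. Otherwise let [T] be
    the tight set of a maximal sparse [I]: every edge with an end outside [span T] belongs to [I],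
    and linkedness supplies at least [#|U :\: span T|] of these. *)
Lemma linked_sparse U X : 0 < k -> X \subset edges G -> span X \subset U ->
  linked U X -> ~~ sparse X \/ #|U| + k <= #|X|.+1 ->
  exists I, [/\ I \subset X, sparse I & #|U| + k <= #|I|.+1].
Proof.
move=> k0 XE XU lUX; have [sX [//|leX]|nX _] := boolP (sparse X);
  first by exists X.
have [I [IX sI mI]] := maximal_sparse_ex X k0.
exists I; split=> //.
have [T [TI /eqP tT outT]] := maximal_sparse_tight nX IX sI mI.
have TU : span T \subset U by apply: subset_trans XU;
  rewrite spanS ?(subset_trans TI).
have T0 : span T != set0.
  have [e eXI] : exists e, e \in X :\: I.
    by apply/set0Pn; apply: contraNneq nX => /eqP;
      rewrite setD_eq0 => /sparseS; apply.
  have /setDP[eX _] := eXI; have /andP[+ _] := ends_card (subsetP XE _ eX).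
  by rewrite !card_gt0; apply: contra_neq => T0; apply/eqP;
    rewrite -subset0 -T0 outT.
have := linked_edges_out XE lUX TU T0.
set F := [set e in X | _] => leF.
have FI : F \subset I :\: T.
  apply/subsetP => e; rewrite !inE => /andP[eX eNT].
  apply/andP; split; first by apply: contraNN eNT; apply: span_sub.
  by apply: contraNT eNT => eNI; apply: outT; rewrite inE eNI.
have := subset_leq_card FI; have := cardsD U (span T); have := cardsD I T.
rewrite (setIidPr TI) (setIidPr TU).
have := subset_leq_card TI; have := subset_leq_card TU.
clear -leF tT; lia.
Qed.

Lemma sparse_leq U X : sparse X -> span X \subset U -> #|X| < #|U| + k.
Proof.
move=> /sparseP/(_ X (subxx _)) lt XU; apply: leq_trans lt _.
by rewrite leq_add2r subset_leq_card.
Qed.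

(** Adding [e] to a subset of [I] raises the edge count by at most one, and the new end [x] raises
    the span by at least one. *)
Lemma sparse_pendant x e I : x \in ends G e -> x \notin span I -> sparse I ->
  sparse (e |: I).
Proof.
move=> xe xI /sparseP sI; apply/sparseP => Y YeI.
have [eY|eNY] := boolP (e \in Y); last first.
  apply: sI; apply/subsetP => f fY; have /setU1P[fe|//] := subsetP YeI f fY.
  by rewrite -fe fY in eNY.
have YI : Y :\ e \subset I by rewrite subDset.
have := sI _ YI.
have : #|x |: span (Y :\ e)| <= #|span Y|.
  apply: subset_leq_card; rewrite subUset sub1set spanS ?subD1set // andbT.
  exact: subsetP (span_sub eY) x xe.
rewrite cardsU1 (contraNN (subsetP (spanS YI) x)) // (cardsD1 e Y) eY /=; lia.
Qed.

(** * Sparse sets are the independent sets of the circular matroid *)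

(** A leaf with its edge, or a whole cycle component, could be removed without lowering edges minus
    vertices, leaving a smaller violating set. The claim [peel] performs this removal. *)
Lemma minimal_nonsparse_bowtie Y : Y \subset edges G -> #|span Y| + k <= #|Y| ->
  (forall Z, Z \proper Y -> #|Z| < #|span Z| + k) -> bowtie (edge_sub G Y).
Proof.
move=> YE leY minY; set H := edge_sub G Y.
have eH : edges H = Y by apply/setIidPl.
have vH : verts H = span Y by rewrite /= (setIidPl YE).
have sH x e : (e \in star H x) = (e \in Y) && (x \in ends G e).
  by rewrite inE eH.
have peel (L : {set E}) (K : {set V}) : L \subset Y -> K \subset span Y ->
    L != set0 -> #|L| <= #|K| -> span (Y :\: L) \subset span Y :\: K -> False.
  move=> LY KY L0 leLK sub.
  have pYL : Y :\: L \proper Y.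
    have [e eL] := set0Pn _ L0; rewrite properE subsetDl; apply/subsetPn;
      exists e.
      exact: subsetP LY e eL.
    by rewrite inE eL.
  have := minY _ pYL; have := subset_leq_card sub.
  rewrite !cardsD (setIidPr LY) (setIidPr KY).
  have := subset_leq_card LY; have := subset_leq_card KY; lia.
have star_ex x : x \in verts H -> exists e, e \in star H x.
  by rewrite vH => /bigcupP[e eY xe]; exists e; rewrite sH eY.
apply/and3P; split.
- apply/forall_inP => x /star_ex[e ex]; rewrite -lt0n ltn_addr //.
  by rewrite card_gt0; apply/set0Pn; exists e.
- apply/forall_inP => x xH; have [e ex] := star_ex _ xH;
  apply/negP => /eqP deg1.
  have eqS : star H x = [set e].
    apply/esym/eqP; rewrite eqEcard sub1set ex cards1 /=.
    by rewrite -deg1 leq_addr.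
  have /andP[eY xe] : (e \in Y) && (x \in ends G e) by rewrite -sH.
  apply: (peel [set e] [set x]); rewrite ?sub1set ?cards1 -?vH //.
    by apply/set0Pn; exists e; rewrite set11.
  apply/bigcupsP => f /setDP[fY fe]; rewrite subsetD1 vH span_sub //=.
  by apply: contraNN fe => xf; rewrite -eqS sH fY.
- apply/forall_inP => x xH; apply/negP => /andP[_ /forall_inP deg2].
  set K := verts (component H x) in deg2; set L := edges (component H x).
  have memK y : (y \in K) = (y \in verts H) && connect (adjacent H) x y.
    by rewrite !in_setI /= inE -andbA andbC -andbA andbb andbC.
  have xK : x \in K by rewrite memK xH connect0.
  have leLK : #|L| = #|K|.
    have := handshake (component H x).
    rewrite (eq_bigr (fun=> 2)) => [|y yK]; last by apply/eqP/deg2.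
    by rewrite sum_nat_const -/K -/L; lia.
  have LY : L \subset Y by rewrite -eH; apply/subsetP => e;
    rewrite inE => /andP[].
  apply: (peel L K); rewrite ?leLK //.
  + by apply/subsetP => y; rewrite memK vH => /andP[].
  + by rewrite -card_gt0 leLK card_gt0; apply/set0Pn; exists x.
  apply/bigcupsP => e /setDP[eY eNL]; apply/subsetP => y ye.
  rewrite inE (subsetP (span_sub eY)) // andbT; apply: contraNN eNL.
  rewrite memK inE eH eY => /andP[yH xy] /=; apply/subsetP => z ze.
  rewrite inE; apply/andP; split; first by have := subsetP (span_sub eY) z ze;
    rewrite -vH.
  apply: connect_trans xy (connect1 _).
  by apply/existsP; exists e; rewrite eH eY ye.
Qed.

Lemma circuitE C : (C \in circuits (circular_matroid k G)) =
  [&& C \subset edges G, #|C| == #|span C| + k & bowtie (edge_sub G C)].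
Proof.
rewrite inE; case: (boolP (C \subset edges G)) => //= CE; congr (_ && _).
by rewrite /excess /= (setIidPl CE) GRing.subr_eq addnC.
Qed.

Lemma independentE X : 0 < k -> X \subset edges G ->
  independent (circular_matroid k G) X = sparse X.
Proof.
move=> k0 XE; rewrite /independent XE /=;
  apply/forall_inP/idP => [indX|/sparseP sX C].
  apply: contraT => /nsparseP[Y0 Y0X leY0].
  pose P Y := (Y \subset X) && (#|span Y| + k <= #|Y|).
  have PY0 : P Y0 by rewrite /P Y0X.
  case: (@arg_minnP _ _ P (fun Y => #|Y|) PY0) => Y /andP[YX leY] minY.
  have YE := subset_trans YX XE.
  have minY' Z : Z \proper Y -> #|Z| < #|span Z| + k.
    move=> pZ; rewrite ltnNge; apply: contraTN (proper_card pZ) => leZ.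
    by rewrite -leqNgt minY // /P leZ (subset_trans (proper_sub pZ)).
  suff /indX : Y \in circuits (circular_matroid k G) by rewrite YX.
  rewrite circuitE YE minimal_nonsparse_bowtie // andbT eqn_leq leY andbT.
  (* A minimal violating [Y] attains the bound: removing one edge makes the inequality strict and
     cannot enlarge the span. *)
  have [e eY] : exists e, e \in Y by apply/set0Pn; rewrite -card_gt0; lia.
  have := minY' _ (properD1 eY); have := subset_leq_card (spanS (subD1set Y e)).
  have := cardsD1 e Y; rewrite eY; lia.
rewrite circuitE => /and3P[_ /eqP cC _]; apply/negP => /sX.
by rewrite cC ltnn.
Qed.

End Sparse.

(** * Reading the number of spanned vertices off the matroid *)

(** For each [e] in [X], linkedness of [X :\ e] gives a sparse set of the largest size that [U]
    allows and avoiding [e]. So [X] has no coloop, and its rank is known. Both facts mention only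
    sparsity and hence pass to [G'], where [coloopless_sparse_card] applies. *)
Lemma coloopless_span_card (V V' E : finType) (k : nat) (G : mgraph V E)
    (G' : mgraph V' E) (U : {set V}) (X : {set E}) :
  0 < k -> {in powerset (edges G), sparse G k =1 sparse G' k} ->
  X \subset edges G -> span G X \subset U ->
  {in X, forall e, linked G U (X :\ e)} -> #|U| + k <= #|X| ->
  #|span G' X| = #|U|.
Proof.
move=> k0 eqs XE XU lX leX.
have eqs' (Y : {set E}) : Y \subset X -> sparse G k Y = sparse G' k Y.
  by move=> YX; apply: eqs; rewrite inE (subset_trans YX).
have basis e : e \in X ->
    exists J : {set E}, [/\ J \subset X :\ e, sparse G' k J & #|U| + k =
      #|J|.+1].
  move=> eX; have X'X := subD1set X e; have cX := cardsD1 e X.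
  have [||J [JX sJ leJ]] := linked_sparse k0 (subset_trans X'X XE) _ (lX e eX).
  - exact: subset_trans (spanS _ X'X) XU.
  - by right; rewrite eX in cX; lia.
  have JX' := subset_trans JX X'X.
  exists J; rewrite -eqs' // sJ; split=> //.
  by apply/eqP; rewrite eqn_leq leJ (sparse_leq sJ) // (subset_trans (spanS G
    JX')).
have dep e (J : {set E}) : e \in X -> J \subset X :\ e -> #|U| + k = #|J|.+1 ->
    ~~ sparse G' k (e |: J).
  move=> eX JX cJ.
  have eJX : e |: J \subset X by rewrite subUset sub1set eX (subset_trans JX)
    ?subD1set.
  rewrite -eqs' //; apply/negP => /sparse_leq/(_ (subset_trans (spanS G eJX)
    XU)).
  have eNJ : e \notin J by apply: contraTN JX => eJ; apply/subsetPn; exists e;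
    rewrite ?setD11.
  by rewrite cardsU1 eNJ; lia.
have X0 : X != set0 by rewrite -card_gt0; lia.
have [e0 e0X] := set0Pn _ X0; have [I [IX sI cI]] := basis _ e0X.
apply/eqP; rewrite -(eqn_add2r k) cI; apply/eqP/esym.
apply: coloopless_sparse_card => //.
- by move=> e eX; have [J [JX sJ cJ]] := basis e eX; exists J; split=> //;
  apply: dep.
- exact: subset_trans IX (subD1set _ _).
- move=> e /setDP[eX eNI]; apply: dep => //.
  by rewrite subsetD1 eNI (subset_trans IX) ?subD1set.
Qed.

(** * Cut properties of connected and 3-connected graphs *)

Section Connectivity.
Variables (V E : finType) (G : mgraph V E).

Lemma connected_linked : connected G -> linked G (verts G) (edges G).
Proof.
move=> /andP[_ /forall_inP conG] A /properP[AV [v vV vA]] /set0Pn[u uA].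
have := conG u (subsetP AV u uA) => /forall_inP/(_ v vV)/connectP[p].
elim: p u uA => [u uA _ /= vu|w p IHp u uA /= /andP[/exists_inP[e eE /andP[ue
  we]] pw] lastv].
  by rewrite vu uA in vA.
have [wA|wA] := boolP (w \in A); first exact: IHp wA pw lastv.
exists e, u, w; split=> //; rewrite inE ?ue ?we // inE wA.
exact: subsetP (ends_sub eE) w we.
Qed.

End Connectivity.

Section ThreeConnected.
Variables (V E : finType) (G : mgraph V E).
Hypothesis G3 : three_connected G.
Implicit Type W : {set V}.

Definition avoiding W : {set E} := [set e in edges G | [disjoint ends G e & W]].

Lemma avoiding_linked W : W \subset verts G -> #|W| <= 2 ->
  linked G (verts G :\: W) (avoiding W).
Proof.
move=> WV leW A pA A0; have [_ _ /(_ W WV leW)/connected_linked lW] := G3.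
have [|e [u [v []]]] := lW A _ A0;
  first by rewrite /= (setIidPl (subsetDl _ _)).
rewrite /= (setIidPl (subsetDl _ _)) inE => /andP[eE eW] ue ve.
exists e, u, v; split=> //; rewrite inE eE.
by move: eW; rewrite subsetD => /andP[].
Qed.

Lemma avoiding1 x : avoiding [set x] = edges G :\: star G x.
Proof.
apply/setP => e; rewrite !inE disjoint_sym disjoints1;
  case: (e \in edges G) => //=.
by rewrite andbT.
Qed.

Lemma card_avoiding1 x : #|avoiding [set x]| + #|star G x| = #|edges G|.
Proof.
rewrite avoiding1 -[RHS](cardsID (star G x)) addnC (setIidPr _) //.
by apply/subsetP => e; rewrite inE => /andP[].
Qed.

(** The graph without [W] has no bridge: one more vertex, an end of [e], may be deleted while
    connectedness persists. *)
Lemma avoidingD1_linked W e : W \subset verts G -> #|W| <= 1 ->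
  e \in avoiding W -> linked G (verts G :\: W) (avoiding W :\ e).
Proof.
move=> WV leW eW A pA A0.
have [f [u [v [fW uf vf]]]] := avoiding_linked WV (leqW leW) pA A0.
have [fe|fe] := eqVneq f e; last by exists f, u, v; rewrite in_setD1 fe.
subst f; move: uf vf; rewrite !inE => /andP[ue uA] /and4P[ve vA vW vV].
have /andP[uW uV] : (u \notin W) && (u \in verts G).
  by have /properP[/subsetP/(_ u uA)] := pA; rewrite inE.
(* Deleting an end w of e as well still leaves an edge across the cut. *)
have via w (B : {set V}) : w \in ends G e -> w \in verts G -> w \notin W ->
    B \proper verts G :\: (w |: W) -> B != set0 -> B \subset A ->
      A \subset w |: B ->
    exists f u v, [/\ f \in avoiding W :\ e, u \in ends G f :&: A
      & v \in ends G f :&: ((verts G :\: W) :\: A)].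
  move=> we wV wW pB B0 BA AB.
  have wWV : w |: W \subset verts G by rewrite subUset sub1set wV.
  have lewW : #|w |: W| <= 2 by rewrite cardsU1 wW.
  have [f [u' [v' []]]] := avoiding_linked wWV lewW pB B0.
  rewrite !inE => /andP[fE dis] /andP[u'f u'B] /and4P[v'f v'B v'wW v'V].
  have wf : w \notin ends G f.
    by apply/negP => wf; have /disjointFr/(_ wf) := dis; rewrite setU11.
  exists f, u', v'; rewrite !inE fE u'f v'f v'V (subsetP BA) //=.
  move: v'wW; rewrite negb_or => /andP[v'w ->]; rewrite !andbT; split=> //.
    apply/andP; split; first by apply: contraNneq wf => ->.
    by apply: disjointWr dis; apply: subsetUr.
  apply: contraNN v'B => v'A; have := subsetP AB v' v'A.
  by case/setU1P => [v'w'|//]; rewrite v'w' eqxx in v'w.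
(* The deleted end must leave both sides of the cut nonempty. If [A] is just [u], delete [v]; the
   other side survives because [G] has at least four vertices. Otherwise delete [u], and [v] remains
   opposite. *)
have [Au|Au] := eqVneq (A :\ u) set0.
  have eqA : A = [set u] by apply/eqP;
    rewrite eqEsubset sub1set uA andbT -setD_eq0 Au.
  have uv : u != v by apply: contraNneq vA => <-.
  apply: (via v A) => //; last exact: subsetUr.
  rewrite properE; apply/andP; split.
    by rewrite eqA sub1set !inE negb_or uv uW.
  have [_ V4 _] := G3; apply/negP => /subset_leq_card;
    rewrite eqA cards1 cardsD.
  have := subset_leq_card (subsetIr (verts G) (v |: W)).
  by rewrite cardsU1 vW /=; clear -V4 leW; lia.
apply: (via u (A :\ u)) => //; last by rewrite setD1K.
  rewrite properE; apply/andP; split.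
    apply/subsetP => w; rewrite !inE negb_or => /andP[-> wA] /=.
    by have /properP[/subsetP/(_ w wA)] := pA; rewrite inE.
  apply/subsetPn; exists v; last by rewrite inE (negPf vA) andbF.
  by rewrite !inE negb_or vW vV !andbT; apply: contraNneq vA => ->.
exact: subD1set.
Qed.

(** Without [y] the graph is still connected with further vertices, so some edge leaves the
    singleton of [x]. *)
Lemma star_neq_ex x y : x \in verts G -> y \in verts G -> x != y ->
  exists2 e, e \in star G x & e \notin star G y.
Proof.
move=> xV yV xy; have [_ V4 _] := G3.
have y1 : [set y] \subset verts G by rewrite sub1set.
have [|||e [u [v []]]] := @avoiding_linked [set y] y1 _ [set x].
- by rewrite cards1.
- rewrite properEcard sub1set !inE xy xV /= cards1.
  by have := cardsD1 y (verts G); rewrite yV; lia.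
- by apply/set0Pn; exists x; rewrite set11.
rewrite avoiding1 => /setDP[eE ey] /setIP[ue /set1P ux] _.
by exists e; rewrite // inE eE -ux.
Qed.

Lemma star_inj : {in verts G &, injective (star G)}.
Proof.
move=> x y xV yV eqS; apply/eqP/negP => /negP xy.
by have [e ex /negP[]] := star_neq_ex xV yV xy; rewrite -eqS.
Qed.

End ThreeConnected.

(** * From equal stars to a strong isomorphism *)

(** Puts the ends of an edge in terms of incidence with each vertex, which is what equality of stars
    preserves; loops are the case [x = y]. *)
Lemma ends_set2P (V E : finType) (G : mgraph V E) e
    (x y : {x | x \in verts G}) : e \in edges G ->
  ends G e = [set val x; val y] <->
  forall w : {x | x \in verts G}, (val w \in ends G e) = (w == x) || (w == y).
Proof.
move=> eE; split=> [-> w|h]; first by rewrite !inE.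
apply/setP => z; have [zV|zV] := boolP (z \in verts G).
  by have := h (Sub z zV); rewrite !inE.
rewrite (contraNF (subsetP (ends_sub eE) z) zV).
by apply/esym/negbTE; apply: contraNN zV => /set2P[] ->; apply: valP.
Qed.

Lemma strongly_isomorphic_stars (V V' E : finType) (G : mgraph V E)
    (G' : mgraph V' E) :
  edges G = edges G' -> {in verts G &, injective (star G)} ->
  #|verts G'| <= #|verts G| ->
  {in verts G, forall x, exists2 x', x' \in verts G' & star G' x' = star G x} ->
  stars G = stars G' /\ strongly_isomorphic G G'.
Proof.
move=> eqE injS leV exS; split.
  apply/eqP; rewrite eqEcard; apply/andP; split.
    apply/subsetP => _ /imsetP[x xV ->]; have [x' x'V <-] := exS x xV.
    exact: imset_f.
  by rewrite (card_in_imset injS) (leq_trans (leq_imset_card _ _)).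
split=> //.
have [nu nuP] : exists nu : {x | x \in verts G} -> {x' | x' \in verts G'},
    forall x, star G' (val (nu x)) = star G (val x).
  have /fin_all_exists[nu nuP] : forall x : {x | x \in verts G},
      exists x' : {x' | x' \in verts G'}, star G' (val x') = star G (val x).
    by move=> x; have [x' x'V ?] := exS _ (valP x); exists (Sub x' x'V).
  by exists nu.
have inj_nu : injective nu.
  by move=> x y eqxy; apply/val_inj/injS;
    rewrite ?(valP x) ?(valP y) // -!nuP eqxy.
have bij_nu : bijective nu by apply: inj_card_bij => //; rewrite !card_sig.
exists nu => // e eE x y; have eE' : e \in edges G' by rewrite -eqE.
have mem_nu w : (val (nu w) \in ends G' e) = (val w \in ends G e).
  by have /setP/(_ e) := nuP w; rewrite !inE eE eE'.
split=> [/(ends_set2P _ _ eE) h | /(ends_set2P _ _ eE') h].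
  apply/(ends_set2P _ _ eE') => w; have [nu' _ nuK'] := bij_nu.
  by rewrite -[w]nuK' mem_nu h !(inj_eq inj_nu).
by apply/(ends_set2P _ _ eE) => w; rewrite -mem_nu h !(inj_eq inj_nu).
Qed.

(** * Comparing the stars of the two graphs *)

(** The star bound is weak enough to hold for [t] too: it need only leave enough edges off [x] for
    one large sparse set, with no spare edge to delete. Adding a missing [f] keeps that set sparse
    in [G], but makes it too large for [verts G' :\ x']. *)
Lemma star_eq_of_subset (V V' E : finType) (k : nat) (G : mgraph V E)
    (G' : mgraph V' E) (x : V) (x' : V') : 0 < k -> three_connected G ->
  {in powerset (edges G), sparse G k =1 sparse G' k} ->
  edges G = edges G' -> #|verts G'| = #|verts G| ->
  x \in verts G -> x' \in verts G' ->
  #|star G x| + #|verts G| + k <= #|edges G| + 2 ->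
  star G' x' \subset star G x -> star G' x' = star G x.
Proof.
move=> k0 G3 eqs eqE eqV xV x'V leS sub; apply/eqP; rewrite eqEsubset sub /=.
apply/subsetP => f fx; apply: contraT => fx'.
have fE : f \in edges G by move: fx; rewrite inE => /andP[].
have x1 : [set x] \subset verts G by rewrite sub1set.
have XE : avoiding G [set x] \subset edges G by rewrite avoiding1 subsetDl.
have XU : span G (avoiding G [set x]) \subset verts G :\ x.
  apply/bigcupsP => e; rewrite avoiding1 => /setDP[eE]; rewrite inE eE /= => ex.
  by rewrite subsetD1 ends_sub.
have cX := cardsD1 x (verts G); rewrite xV in cX.
have [||I [IX sI leI]] := linked_sparse k0 XE XU (avoiding_linked G3 x1 _).
- by rewrite cards1.
- by right; have := card_avoiding1 G x; clear -cX leS; lia.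
have xI : x \notin span G I.
  apply: contraTN (subset_trans (spanS G IX) XU) => xI.
  by apply/subsetPn; exists x; rewrite // setD11.
have xf : x \in ends G f by move: fx; rewrite inE => /andP[].
have fI : f \notin I by apply: contraNN xI => /span_sub/subsetP; apply.
have IE := subset_trans IX XE.
have := sparse_pendant xf xI sI; rewrite eqs; last first.
  by rewrite inE subUset sub1set fE.
move/(sparse_leq (U := verts G' :\ x')); rewrite cardsU1 fI.
have := cardsD1 x' (verts G'); rewrite x'V.
suff -> : span G' (f |: I) \subset verts G' :\ x'
  by move=> + /(_ isT); clear -leI eqV cX; lia.
apply/bigcupsP => e efI; have eE : e \in edges G.
  by case/setU1P: efI => [->|/(subsetP IE)].
rewrite subsetD1 ends_sub -?eqE //=.
have : e \notin star G' x'.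
  case/setU1P: efI => [->//|/(subsetP IX)]; rewrite avoiding1 => /setDP[_].
  exact/contraNN/subsetP.
by rewrite inE -eqE eE.
Qed.

Theorem theorem6p5 (V V' E : finType) (k : nat)
    (G : mgraph V E) (G' : mgraph V' E) (t : V)
    (k_ge1 : 1 <= k)
    (G'_no_isolated : no_isolated G')
    (t_in : t \in verts G)
    (G_3conn : three_connected G)
    (has_circuit : circuits (circular_matroid k G) <> set0)
    (star_t : #|star G t| = (corank (circular_matroid k G)).+1)
    (star_x : forall x, x \in verts G -> x != t ->
       #|star G x| <= corank (circular_matroid k G))
    (same_matroid : circular_matroid k G' = circular_matroid k G) :
  stars G = stars G' /\ strongly_isomorphic G G'.
Proof.
have eqE : edges G = edges G' by have := congr1 (@ground E) same_matroid.
have eqs : {in powerset (edges G), sparse G k =1 sparse G' k}.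
  move=> X; rewrite inE => XE.
  by rewrite -!independentE -?eqE // same_matroid.
have [[G_loopless _] V4 _] := G_3conn.
have spanV (X : {set E}) : X \subset edges G -> span G X \subset verts G.
  by move=> /subsetP XE; apply/bigcupsP => e /XE/ends_sub.
have spanV' (X : {set E}) : X \subset edges G -> span G' X \subset verts G'.
  by rewrite eqE => /subsetP XE; apply/bigcupsP => e /XE/ends_sub.
have avoid0 : avoiding G set0 = edges G.
  by apply/setP => e; rewrite inE disjoint_sym disjoints_subset sub0set andbT.
(* The given circuit makes the whole edge set non-sparse, so [linked_sparse] yields rank at least
   [#|verts G| + k - 1]. *)
have le_corank : corank (circular_matroid k G) + #|verts G| + k <= #|edges
  G|.+1.
  have nsE : ~~ sparse G k (edges G).
    have /eqP/set0Pn[C] := has_circuit;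
      rewrite circuitE => /and3P[CE /eqP cC _].
    by apply/nsparseP; exists C; rewrite ?cC.
  have [|I [IE sI leI]] := linked_sparse k_ge1 (subxx _) (spanV _ (subxx _)) _
    (or_introl nsE).
    by have := @avoiding_linked _ _ _ G_3conn set0;
      rewrite setD0 avoid0 sub0set cards0; apply.
  have le1 : #|I| <= rank (circular_matroid k G).
    by apply: leq_bigmax_cond; rewrite independentE.
  (* This makes the truncated subtraction in [corank] exact. *)
  have le2 : rank (circular_matroid k G) <= #|edges G|.
    by apply/bigmax_leqP => J /andP[JE _]; apply: subset_leq_card.
  rewrite /corank /=; clear -le1 le2 leI; lia.
have star_bound x : x \in verts G -> x != t ->
  #|star G x| + #|verts G| + k <= #|edges G|.+1.
  by move=> xV xt; have := star_x x xV xt; clear -le_corank; lia.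
have star_bound2 x : x \in verts G ->
  #|star G x| + #|verts G| + k <= #|edges G| + 2.
  move=> xV; have [->|xt] := eqVneq x t; first by clear -star_t le_corank; lia.
  by have := star_bound x xV xt; clear; lia.
(* A vertex other than [t] with nonempty star turns [star_bound] into
   [#|verts G| + k <= #|edges G|], the size needed to apply [coloopless_span_card] to all edges. *)
have [y yV yt] : exists2 y, y \in verts G & y != t.
  have /set0Pn[y] : verts G :\ t != set0.
    by have := cardsD1 t (verts G); rewrite -card_gt0 t_in; clear -V4; lia.
  by rewrite !inE => /andP[yt yV]; exists y.
have star_gt0 : 0 < #|star G y|.
  have [e ey _] := star_neq_ex G_3conn yV t_in yt.
  by rewrite card_gt0; apply/set0Pn; exists e.
have eqV : #|verts G'| = #|verts G|.
  rewrite -(@coloopless_span_card _ _ _ k G G' (verts G) (edges G)) //;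
    last first.
  - by have := star_bound y yV yt; clear -star_gt0; lia.
  - move=> e eE; have := @avoidingD1_linked _ _ _ G_3conn set0 e.
    by rewrite setD0 avoid0 sub0set cards0; apply.
  - exact: spanV.
  congr #|pred_of_set _|; apply/eqP; rewrite eqEsubset spanV' // andbT.
  apply/subsetP => x' x'V; have := forall_inP G'_no_isolated x' x'V.
  rewrite -lt0n addn_gt0 !card_gt0 => /orP[] /set0Pn[e];
    rewrite inE => /andP[eE].
    by move=> x'e; apply: mem_span x'e; rewrite eqE.
  by move/eqP=> ex'; apply: (@mem_span _ _ _ _ e); rewrite ?eqE // ex' set11.
have star_image x : x \in verts G -> x != t ->
    exists2 x', x' \in verts G' & star G' x' = star G x.
  move=> xV xt; pose X := avoiding G [set x].
  have XE : X \subset edges G by rewrite /X avoiding1 subsetDl.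
  have x1 : [set x] \subset verts G by rewrite sub1set.
  have cV := cardsD1 x (verts G); rewrite xV in cV.
  have cspan : #|span G' X| = #|verts G :\ x|.
    apply: (coloopless_span_card k_ge1 eqs XE).
    - apply/bigcupsP => e; rewrite /X avoiding1 => /setDP[eE];
      rewrite inE eE /= => ex.
      by rewrite subsetD1 ends_sub.
    - by move=> e eX; apply: avoidingD1_linked; rewrite ?cards1.
    by have := star_bound x xV xt; have := card_avoiding1 G x; rewrite -/X;
      clear -cV; lia.
  (* The edges off [x] span one vertex fewer than [G'] has; at the vertex missed, only edges of
     [star G x] can occur. *)
  have [x' x'V x'X] : exists2 x', x' \in verts G' & x' \notin span G' X.
    apply/subsetPn; apply/negP => /subset_leq_card; rewrite cspan eqV.
    by clear -cV; lia.
  exists x' => //; apply: (star_eq_of_subset k_ge1 G_3conn eqs) => //;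
    first exact: star_bound2.
  apply/subsetP => e; rewrite inE -eqE => /andP[eE x'e];
    apply: contraNT x'X => ex.
  by apply: mem_span x'e; rewrite /X avoiding1 inE ex.
have star_injG := star_inj G_3conn.
apply: strongly_isomorphic_stars => //; first by rewrite eqV.
have [y' y'V _] := star_image y yV yt.
(* Outside [verts G :\ t] the value [y'] is a dummy. The image of that set has at most
   [#|verts G| - 1] elements, so some vertex [t'] of [G'] is left over. *)
have /fin_all_exists[f fP] : forall x, exists x', x \in verts G :\ t ->
    x' \in verts G' /\ star G' x' = star G x.
  move=> x; have [/setD1P[xt xV]|_] := boolP (x \in verts G :\ t);
    last by exists y'.
  by have [x' x'V ex'] := star_image x xV xt; exists x'.
have [t' t'V t'f] : exists2 t', t' \in verts G' & t' \notin f @: (verts G :\ t).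
  apply/subsetPn; apply/negP => /subset_leq_card.
  have := leq_imset_card f (verts G :\ t); have := cardsD1 t (verts G).
  by rewrite t_in eqV; clear; lia.
move=> x xV; have [->|xt] := eqVneq x t; last exact: star_image.
exists t' => //; apply: (star_eq_of_subset k_ge1 G_3conn eqs) => //;
  first exact: star_bound2.
(* An edge of G missing t has two ends, whose images exhaust its ends in G'. *)
apply/subsetP => e; rewrite inE -eqE => /andP[eE t'e]; apply: contraT => et.
have /eqP/cards2P[u [v [uv euv]]] := G_loopless e eE.
have ends_t w : w \in ends G e -> w \in verts G :\ t.
  move=> we; rewrite !inE (subsetP (ends_sub eE)) // andbT.
  by apply: contraNneq et => <-; rewrite inE eE.
have ends_f w : w \in ends G e -> f w \in ends G' e /\ f w != t'.
  move=> we; have [_ /setP/(_ e)] := fP w (ends_t w we).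
  rewrite !inE -eqE eE we => /= ->; split=> //.
  by apply: contraNneq t'f => <-; apply: imset_f; apply: ends_t.
have [ue ve] : u \in ends G e /\ v \in ends G e by rewrite euv set21 set22.
have [[fue fut] [fve fvt]] := (ends_f u ue, ends_f v ve).
have fuv : f u != f v.
  have [[_ su] [_ sv]] := (fP u (ends_t u ue), fP v (ends_t v ve)).
  apply: contra_neq uv => efuv; apply: star_injG; rewrite -?su -?sv ?efuv //.
    exact: subsetP (ends_sub eE) u ue.
  exact: subsetP (ends_sub eE) v ve.
have eE' : e \in edges G' by rewrite -eqE.
have : [set t'; f u; f v] \subset ends G' e by rewrite !subUset !sub1set t'e
  fue fve.
move=> /subset_leq_card; rewrite -setUA cardsU1 !inE cards2 fuv.
rewrite ![t' == _]eq_sym (negPf fut) (negPf fvt) /= => le3.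
by have /andP[_] := ends_card eE'; rewrite leqNgt le3.
Qed.
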